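(* Let $\mathbf{k}$ be a field, let $n\ge 2$, and consider the cubic $$f_n=\sum_{1\le i<j\le n}x_ix_jy_{ij}$$ in the polynomial ring $\mathbf{k}[x_i, y_{jk}\ |\ 1\le i\le n,\ 1\le j<k\le n]$. Then $$\operatorname{rk}(f_n)=n-1 \quad\text{and}\quad \dim L_{f_n}=n+\binom{n}{2}.$$
   Context: A subspace of linear forms is a $\mathbf{k}$-linear subspace of the space of homogeneous degree $1$ polynomials in the given polynomial ring; for such a subspace $P$, $(P)$ denotes the ideal it generates. For a homogeneous cubic polynomial $f$, the slice rank $\operatorname{rk}(f)$ is the minimal number $r$ such that $f$ belongs to the ideal $(\ell_1,\ldots,\ell_r)$ generated by $r$ linear forms. Let $\mathcal{P}_f$ denote the set of all subspaces of linear forms $P$ with $\dim P=\operatorname{rk}(f)$ and $f\in (P)$, and set $L_f:=\sum_{P\in\mathcal{P}_f}P$. *)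

(* Defs.v *)
From mathcomp Require Import all_boot all_order all_algebra.
From mathcomp Require Import boolp.
From mathcomp Require Export mpoly.

Set Implicit Arguments.
Unset Strict Implicit.
Unset Printing Implicit Defensive.

Import GRing.Theory.
Local Open Scope ring_scope.

Section Ideal.
Variable R : comNzRingType.

Definition in_ideal (S : R -> Prop) (f : R) : Prop :=
  exists (m : nat) (c g : 'I_m -> R),
    (forall i, S (g i)) /\ f = \sum_(i < m) c i * g i.

End Ideal.

Section FamilySum.
Variables (K : fieldType) (V : vectType K) (F : {vspace V} -> Prop).

Definition is_family_sum (L : {vspace V}) : Prop :=
  forall v : V, v \in L <->
    exists s : seq {vspace V},
      (forall U, U \in s -> F U) /\ v \in (\sum_(U <- s) U)%VS.

(* A finite partial sum of maximal dimension already contains all the others. *)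
Lemma family_sum_ex : exists L, is_family_sum L.
Proof.
pose A d := `[< exists s : seq {vspace V},
  (forall U, U \in s -> F U) /\ \dim (\sum_(U <- s) U)%VS = d >].
have A0 : exists d, A d.
  by exists 0%N; apply/asboolP; exists [::]; split=> //; rewrite big_nil dimv0.
have Ab d : A d -> (d <= \dim {:V})%N.
  by move=> /asboolP[s [_ <-]]; exact/dimvS/subvf.
case: (ex_maxnP A0 Ab) => d /asboolP[s [sF sd]] dmax.
exists (\sum_(U <- s) U)%VS => v; split; first by exists s.
case=> t [tF vt].
suff -> : (\sum_(U <- s) U)%VS = (\sum_(U <- s ++ t) U)%VS.
  by rewrite big_cat /= -[v]add0r; apply: memv_add => //; exact: mem0v.
apply/eqP; rewrite eqEdim {1}big_cat /= addvSl sd; apply: dmax.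
apply/asboolP; exists (s ++ t); split=> // U.
by rewrite mem_cat => /orP[/sF|/tF].
Qed.

(* The sum of a possibly infinite family of subspaces. *)
Definition family_sum : {vspace V} := projT1 (cid family_sum_ex).

End FamilySum.

(* Polynomials in N.+1 variables: the library provides the vector space
   structure on homogeneous polynomials only for a positive number of
   variables. *)
Section SliceRank.
Variables (k : fieldType) (N : nat).

Local Notation linform := (dhomog N.+1 k 1).
Local Notation cubic := (dhomog N.+1 k 3).

Definition generated_by (f : cubic) (r : nat) : Prop :=
  exists l : r.-tuple linform,
    in_ideal (fun g : {mpoly k[N.+1]} => exists i, g = val (tnth l i)) (val f).

Lemma generated_by_ex (f : cubic) : exists r, `[< generated_by f r >].
Proof.
have hX (i : 'I_N.+1) : ('X_i : {mpoly k[N.+1]}) \is 1.-homog.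
  by rewrite dhomogX; apply/eqP; exact: mdeg1.
exists N.+1; apply/asboolP; exists [tuple DHomog (hX i) | i < N.+1].
pose I := fun p : {mpoly k[N.+1]} =>
  exists c : 'I_N.+1 -> {mpoly k[N.+1]}, p = \sum_i c i * 'X_i.
suff [c fE] : I (val f).
  exists N.+1, c, (fun i => 'X_i); split=> // i.
  by exists i; rewrite tnth_mktuple.
have I0 : I 0 by exists (fun=> 0); rewrite big1 // => i _; rewrite mul0r.
have ID p q : I p -> I q -> I (p + q).
  move=> [c ->] [d ->]; exists (fun i => c i + d i).
  by rewrite -big_split; apply: eq_bigr => i _; rewrite mulrDl.
rewrite [val f]mpolyE big_seq; apply: (big_ind I I0 ID) => m mf.
have /eqP : mdeg m = 3%N.
  by have /dhomogP := dhomog_is_dhomog f; apply; exact: mf.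
have [i mi|m0] := pickP (fun i : 'I_N.+1 => m i != 0%N); last first.
  by rewrite mdegE big1 // => i _; apply/eqP; rewrite -[_ == _]negbK m0.
move=> _; exists (fun j => if j == i then (val f)@_m *: 'X_[m - U_(i)] else 0).
rewrite (bigD1 i) //= eqxx big1 ?addr0 => [|j /negPf ->]; last by rewrite mul0r.
rewrite -scalerAl -mpolyXD; congr (_ *: 'X_[_]).
by rewrite submK // lep1mP.
Qed.

Definition slice_rank (f : cubic) : nat := ex_minn (generated_by_ex f).

Definition min_space (f : cubic) (P : {vspace linform}) : Prop :=
  \dim P = slice_rank f /\
  in_ideal (fun g : {mpoly k[N.+1]} => exists2 l : linform, l \in P & g = val l)
    (val f).

Definition L_space (f : cubic) : {vspace linform} := family_sum (min_space f).

End SliceRank.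

Section Fn.
Variables (k : fieldType) (n : nat).

Definition pairs : finType := {p : 'I_n * 'I_n | (p.1 < p.2)%N}.

(* inl i stands for x_i and inr (i, j) for y_ij. *)
Definition fvar : finType := ('I_n + pairs)%type.

(* fvar numbers the variables 0, ..., nv, as soon as 0 < n. *)
Definition nv : nat := #|fvar|.-1.

Definition fvar_index (v : fvar) : 'I_nv.+1 := inord (enum_rank v).

Lemma fvar_index_bij : (0 < n)%N -> bijective fvar_index.
Proof.
move=> n0; have cE : #|fvar| = nv.+1.
  by rewrite prednK //; apply/card_gt0P; exists (inl (Ordinal n0)).
apply: inj_card_bij; last by rewrite card_ord cE.
move=> u v /(congr1 val); rewrite /= !inordK -?cE ?ltn_ord // => uv.
exact/enum_rank_inj/val_inj.
Qed.

Definition xvar (i : 'I_n) : {mpoly k[nv.+1]} := 'X_(fvar_index (inl i)).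
Definition yvar (p : pairs) : {mpoly k[nv.+1]} := 'X_(fvar_index (inr p)).

Definition fn_mpoly : {mpoly k[nv.+1]} :=
  \sum_(p : pairs) xvar (val p).1 * xvar (val p).2 * yvar p.

Lemma fn_mpoly_homog : fn_mpoly \is 3.-homog.
Proof.
apply: rpred_sum => p _; rewrite -!mpolyXD dhomogX.
by rewrite /= !mdegD !mdeg1.
Qed.

Definition fn : dhomog nv.+1 k 3 := DHomog fn_mpoly_homog.

End Fn.

(* Main.v *)
Require Import Defs.
From HB Require Import structures.
From mathcomp Require Import all_boot all_order all_algebra.
From mathcomp Require Import boolp.

Set Implicit Arguments.
Unset Strict Implicit.
Unset Printing Implicit Defensive.

Import GRing.Theory.
Local Open Scope ring_scope.

(** The bound [rk f_n <= n - 1] and the fact that [L_{f_n}] contains all linear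
forms come from writing down spaces.  A set of variables that meets every monomial
[x_i x_j y_ij] spans a space whose ideal contains [f_n].  There are two kinds
of such sets with [n - 1] elements: all the [x_j] but one, and, for a pair
[i < j], the variable [y_ij] together with all the [x_l], [l] different from
[i] and [j].  Once [n - 1] is known to be the slice rank, these sets belong to
[P_{f_n}] and between them contain every variable, so the sum of the spaces is
the whole space of linear forms, whose dimension is the number of variables.

The lower bound is an induction over sets [S] of indices, for the cubic [f_S]
made of the terms of [f_n] with both indices in [S]: if [f_S] lies in the
ideal generated by a space [P] of linear forms, then [#|S| <= dim P + 1]
([fn_on_ideal_rank]).  A linear substitution that kills a nonzero form of [P]
and turns [f_S] into [f_(S minus j)] lowers [#|S|] by one and [dim P] by at
least one, which is the inductive step.
Setting [x_j = 0] already has the second effect, and leaves the images of the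
[y_ij] free.
- If some form of [P] involves [y_ij] with [i, j] in [S], set [x_j = 0] and
  choose the image of [y_ij] so that this form vanishes.
- Otherwise, for [i, j] in [S], differentiating with respect to [y_ij]
  preserves the ideal [(P)], hence [x_i x_j] lies in [(P)].  Modulo [P] the
  polynomial ring is again a polynomial ring, so [(P)] is prime and contains
  [x_i] or [x_j]; if it contains [x_j], say, setting [x_j = 0] kills a form of [P].

In the lower bound, spaces of linear forms are row spaces of matrices of
coefficients, so that linear substitutions are matrix products. *)

(** * Linear forms and linear substitutions *)

Section LinearForms.
Variables (k : fieldType) (N : nat).
Implicit Types (v w : 'rV[k]_N) (A : 'M[k]_N) (p q : {mpoly k[N]}).

Definition lin v : {mpoly k[N]} := \sum_i v 0 i *: 'X_i.

Definition unit_row i : 'rV[k]_N := delta_mx 0 i.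

Lemma lin_is_linear : linear lin.
Proof.
move=> a v w; rewrite /lin scaler_sumr -big_split; apply: eq_bigr => i _ /=.
by rewrite !mxE scalerDl scalerA.
Qed.

HB.instance Definition _ :=
  GRing.isLinear.Build k 'rV[k]_N {mpoly k[N]} _ lin lin_is_linear.

Lemma lin_unit_row i : lin (unit_row i) = 'X_i.
Proof.
rewrite /lin (bigD1 i) //= big1 => [|j /negPf ji]; last first.
  by rewrite mxE ji scale0r.
by rewrite mxE !eqxx scale1r addr0.
Qed.

Lemma mcoeff_lin v i : (lin v)@_U_(i) = v 0 i.
Proof.
rewrite /lin raddf_sum (bigD1 i) //= big1 => [|j /negPf ji]; last first.
  by rewrite mcoeffZ mcoeffXU ji mulr0.
by rewrite mcoeffZ mcoeffXU eqxx mulr1 addr0.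
Qed.

Lemma lin_inj : injective lin.
Proof. by move=> v w vw; apply/rowP => i; rewrite -!mcoeff_lin vw. Qed.

Lemma mderiv_lin v i : (lin v)^`M(i) = (v 0 i)%:MP.
Proof.
rewrite /lin raddf_sum (bigD1 i) //= big1 => [|j /negPf ji]; last first.
  by rewrite mderivZ mderivX mnm1E ji scale0r scaler0.
rewrite mderivZ mderivX mnm1E eqxx scale1r addr0.
rewrite (_ : (_ - _)%MM = 0%MM) ?mpolyX0 ?alg_mpolyC //.
by apply/mnmP => j; rewrite mnmBE subnn mnm0E.
Qed.

Lemma linP p : p \is 1.-homog -> p = lin (\row_i p@_U_(i)).
Proof.
move=> /dhomogP hp; apply/mpolyP => m.
have [/eqP/mdeg1P [i /eqP ->]|m1] := altP (mdeg m =P 1%N).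
  by rewrite mcoeff_lin mxE.
rewrite memN_msupp_eq0; last by apply: contra m1 => /hp ->.
rewrite /lin raddf_sum big1 // => i _ /=; rewrite mcoeffZ mcoeffX.
have [mE|_] := eqVneq U_(i)%MM m; last by rewrite mulr0.
by move: m1; rewrite -mE mdeg1.
Qed.

(** A linear change of variables: on the coefficient vectors of linear forms
it is the product by [A] on the right. *)
Definition subst_mx A p := p \mPo [tuple lin (row i A) | i < N].

HB.instance Definition _ A := GRing.RMorphism.copy (subst_mx A)
  (comp_mpoly [tuple lin (row i A) | i < N]).

Lemma subst_mxX A i : subst_mx A 'X_i = lin (row i A).
Proof. by rewrite /subst_mx comp_mpolyXU -tnth_nth tnth_mktuple. Qed.

Lemma subst_mx_lin A v : subst_mx A (lin v) = lin (v *m A).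
Proof.
rewrite mulmx_sum_row linear_sum {1}/lin /subst_mx raddf_sum.
apply: eq_bigr => i _ /=.
by rewrite comp_mpolyZ linearZ /= -/(subst_mx A _) subst_mxX.
Qed.

Definition rank1 (i : 'I_N) (u : 'rV[k]_N) : 'M[k]_N :=
  delta_mx i (0 : 'I_1) *m u.

Lemma mul_rank1 v i u : v *m rank1 i u = v 0 i *: u.
Proof.
rewrite mulmxA -colE (_ : col i v = (v 0 i)%:M) ?mul_scalar_mx //.
by apply/matrixP => a b; rewrite !ord1 !mxE.
Qed.

(** Membership in the ideal generated by the linear forms whose coefficient
vectors lie in the row space of [P]. *)
Definition in_span_ideal m (P : 'M[k]_(m, N)) : {mpoly k[N]} -> Prop :=
  in_ideal (fun g => exists2 v, (v <= P)%MS & g = lin v).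

End LinearForms.

(** * Ideals generated by linear forms *)

Section Ideals.

Lemma in_ideal_rmorph (R R' : comNzRingType) (h : {rmorphism R -> R'})
    (S : R -> Prop) (S' : R' -> Prop) f :
  (forall g, S g -> S' (h g)) -> in_ideal S f -> in_ideal S' (h f).
Proof.
move=> hS [m [c [g [Sg ->]]]]; exists m, (h \o c), (h \o g); split=> [i|].
  exact/hS/Sg.
by rewrite rmorph_sum; apply: eq_bigr => i _; rewrite rmorphM.
Qed.

Lemma in_ideal_sum (R : comNzRingType) (S : R -> Prop) (T : finType)
    (F : T -> R) :
  (forall t, exists c g, S g /\ F t = c * g) -> in_ideal S (\sum_t F t).
Proof.
move=> FS; have /fin_all_exists [cg cgP] : forall t, exists cg : R * R,
    S cg.2 /\ F t = cg.1 * cg.2.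
  by move=> t; have [c [g cg]] := FS t; exists (c, g).
exists #|T|, (fun i => (cg (enum_val i)).1), (fun i => (cg (enum_val i)).2).
split=> [i|]; first by have [] := cgP (enum_val i).
rewrite (reindex_omap enum_val (fun t => Some (enum_rank t))) /=; last first.
  by move=> t _; rewrite enum_rankK.
apply: eq_big => [i|i _]; first by rewrite enum_valK eqxx.
by have [] := cgP (enum_val i).
Qed.

Variables (k : fieldType) (N : nat).

Lemma in_span_ideal_subst m (P : 'M[k]_(m, N)) A f :
  in_span_ideal P f -> in_span_ideal (P *m A) (subst_mx A f).
Proof.
apply: in_ideal_rmorph => _ [v vP ->]; exists (v *m A); first exact: submxMr.
exact: subst_mx_lin.
Qed.

(** In Leibniz's rule for [c * g], the term with the derivative of the
generator [g] disappears. *)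
Lemma in_span_ideal_mderiv m (P : 'M[k]_(m, N)) i f :
  (forall v : 'rV_N, (v <= P)%MS -> v 0 i = 0) ->
  in_span_ideal P f -> in_span_ideal P f^`M(i).
Proof.
move=> Pi [r [c [g [gP ->]]]]; exists r, (fun a => (c a)^`M(i)), g; split=> //.
rewrite raddf_sum; apply: eq_bigr => a _ /=.
by have [v /Pi vi ->] := gP a; rewrite mderivM mderiv_lin vi mpolyC0 mulr0 addr0.
Qed.

(** Substitution by [cokermx P] is the quotient map modulo [P]: its target is a
domain, which is how the primality of the ideal is used. *)
Lemma in_span_ideal_coker m (P : 'M[k]_(m, N)) f :
  in_span_ideal P f -> subst_mx (cokermx P) f = 0.
Proof.
move=> [r [c [g [gP ->]]]]; rewrite raddf_sum big1 // => a _.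
have [v] := gP a; rewrite submxE => /eqP vP ->.
by rewrite /= rmorphM /= subst_mx_lin vP linear0 mulr0.
Qed.

Lemma mxrankM_lt m (P : 'M[k]_(m, N)) (A : 'M[k]_N) (v : 'rV_N) :
  (v <= P)%MS -> v != 0 -> v *m A = 0 -> (\rank (P *m A) < \rank P)%N.
Proof.
move=> vP v0 vA; rewrite -[ltnRHS](mxrank_mul_ker P A) -[ltnLHS]addn0 ltn_add2l.
rewrite lt0n mxrank_eq0; apply: contraNneq v0 => PA0.
by rewrite -submx0 -PA0 sub_capmx vP; apply/sub_kermxP.
Qed.

End Ideals.

(** * The lower bound *)

Section LowerBound.
Variables (k : fieldType) (n : nat).
Hypothesis n_gt0 : (0 < n)%N.

Local Notation N := (nv n).+1.
Local Notation X := (fun i => fvar_index (inl i : fvar n)).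
Local Notation Y := (fun p => fvar_index (inr p : fvar n)).
Implicit Types (S : {set 'I_n}) (p q : pairs n).

Definition inside S p := ((val p).1 \in S) && ((val p).2 \in S).

Definition fn_on S : {mpoly k[N]} :=
  \sum_(p : pairs n | inside S p)
    xvar k (val p).1 * xvar k (val p).2 * yvar k p.

Lemma fn_on_setT : fn_on setT = fn_mpoly k n.
Proof. by apply: eq_bigl => p; rewrite /inside !inE. Qed.

Let idx_inj : injective (@fvar_index n) := bij_inj (fvar_index_bij n_gt0).

(** Setting [x_j] to zero removes the terms that contain it, and with them the
variables [y_p] with [j] in [p], whose images are therefore arbitrary. *)
Lemma subst_fn_on S j (A : 'M[k]_N) :
  row (X j) A = 0 ->
  (forall i, i != j -> row (X i) A = unit_row k (X i)) ->
  (forall p, inside (S :\ j) p -> row (Y p) A = unit_row k (Y p)) ->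
  subst_mx A (fn_on S) = fn_on (S :\ j).
Proof.
move=> Aj Ai Ay; rewrite /fn_on rmorph_sum /=.
rewrite [RHS]big_mkcond [LHS]big_mkcond; apply: eq_bigr => p _.
have [pSj|] := boolP (inside (S :\ j) p).
  have := pSj; rewrite /inside !inE => /andP[/andP[p1 ->] /andP[p2 ->]] /=.
  by rewrite !rmorphM /= !subst_mxX Ay // !Ai // !lin_unit_row.
rewrite /inside !inE; case: ifP => // /andP[-> ->].
rewrite !andbT negb_and !negbK.
rewrite !rmorphM /= !subst_mxX.
by case/orP => /eqP->; rewrite Aj linear0 ?mulr0 !mul0r.
Qed.

(** For [x != y], the substitution that sends [x] to [0], [y] to [y - u] and
fixes the other variables. *)
Definition elim_mx (x y : 'I_N) (u : 'rV[k]_N) : 'M[k]_N :=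
  1%:M - rank1 x (unit_row k x) - rank1 y u.

Lemma mul_elim_mx v x y u :
  v *m elim_mx x y u = v - v 0 x *: unit_row k x - v 0 y *: u.
Proof. by rewrite !mulmxBr mulmx1 !mul_rank1. Qed.

Lemma row_elim_mx z x y u :
  row z (elim_mx x y u) =
    unit_row k z - (z == x)%:R *: unit_row k x - (z == y)%:R *: u.
Proof. by rewrite rowE mul_elim_mx !mxE eqxx ![_ == z]eq_sym. Qed.

Lemma subst_elim_fn_on S j p u : ~~ inside (S :\ j) p ->
  subst_mx (elim_mx (X j) (Y p) u) (fn_on S) = fn_on (S :\ j).
Proof.
move=> pj; apply: subst_fn_on => [|i ij|q qS];
  rewrite row_elim_mx !(inj_eq idx_inj).
- by rewrite eqxx scale1r subrr sub0r scale0r oppr0.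
- by rewrite [_ == _](inj_eq (@inl_inj _ _)) (negPf ij) !scale0r !subr0.
rewrite [inr q == inr p](inj_eq (@inr_inj _ _)) (_ : (q == p) = false).
  by rewrite !scale0r !subr0.
by apply: contraNF pj => /eqP <-.
Qed.

Lemma exists_inside S : (1 < #|S|)%N -> exists p, inside S p.
Proof.
case/card_gt1P => i [j [iS jS]]; rewrite neq_ltn => /orP[ij|ji].
  by exists (exist _ (i, j) ij); rewrite /inside /= iS.
by exists (exist _ (j, i) ji); rewrite /inside /= iS jS.
Qed.

Lemma mderiv_fn_on S p : inside S p ->
  (fn_on S)^`M(Y p) = xvar k (val p).1 * xvar k (val p).2.
Proof.
have dX z : ('X_(fvar_index z) : {mpoly k[N]})^`M(Y p) = (z == inr p)%:R%:MP.
  by rewrite -lin_unit_row mderiv_lin mxE eqxx eq_sym (inj_eq idx_inj).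
move=> pS; rewrite raddf_sum (bigD1 p) //= big1 ?addr0 => [|q /andP[_ qp]].
  by rewrite !mderivM !dX eqxx !mpolyC0 mul0r mulr0 addr0 mul0r add0r mulr1.
rewrite !mderivM !dX !mpolyC0 [_ == _](inj_eq (@inr_inj _ _)) (negPf qp) mpolyC0.
rewrite !(mul0r, mulr0, addr0) //.
Qed.

(** By induction on [#|S|].  The bound can fail only for [#|S| > 1], where [S]
contains a pair [p]; each case of the proof refutes a possible shape of [P] by
an elimination, until the primality of the ideal gives the contradiction. *)
Lemma fn_on_ideal_rank m (P : 'M[k]_(m, N)) S :
  in_span_ideal P (fn_on S) -> (#|S| <= (\rank P).+1)%N.
Proof.
have [r] := ubnP #|S|; elim: r => // r IHr in P S *.
rewrite ltnS => Sr fP; rewrite leqNgt; apply/negP => Slt.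
have [p pS] : exists p, inside S p.
  by apply: exists_inside; apply: leq_ltn_trans Slt.
(* A nonzero form of [P] that is killed contradicts the induction hypothesis. *)
have step u j q : ~~ inside (S :\ j) q -> j \in S -> forall v : 'rV_N,
  (v <= P)%MS -> v != 0 -> v *m elim_mx (X j) (Y q) u = 0 -> False.
  move=> qj jS v vP v0 vA; have Sj := cardsD1 j S; rewrite jS add1n in Sj.
  have /IHr : in_span_ideal (P *m elim_mx (X j) (Y q) u) (fn_on (S :\ j)).
    by rewrite -(subst_elim_fn_on u qj); apply: in_span_ideal_subst.
  rewrite -Sj => /(_ Sr); have := mxrankM_lt vP v0 vA; move: Slt; rewrite Sj.
  rewrite !ltnS => a b c; by have := leq_trans a (leq_trans c b); rewrite ltnn.
have Pyvar (v : 'rV_N) : (v <= P)%MS -> v 0 (Y p) = 0.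
  move=> vP; apply/eqP/negP => /negP vy.
  (* [v] becomes [w] once [x_j] is set to zero, and [y_p] still has the
     coefficient of [v] there; subtracting [w], rescaled, from [y_p] kills it. *)
  pose w := v - v 0 (X (val p).2) *: unit_row k (X (val p).2).
  apply: (step ((v 0 (Y p))^-1 *: w) (val p).2 p _ _ v) => //.
  - by rewrite /inside !inE eqxx andbF.
  - by have /andP[] := pS.
  - by apply: contraNneq vy => ->; rewrite mxE.
  by rewrite mul_elim_mx -/w scalerA divff // scale1r subrr.
have Pxvar j : ~~ inside (S :\ j) p -> j \in S -> ~~ (unit_row k (X j) <= P)%MS.
  move=> pj jS; apply/negP => xP; apply: (step 0 j p pj jS _ xP).
    by apply/eqP => /rowP/(_ (X j))/eqP; rewrite !mxE !eqxx oner_eq0.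
  (* With [u = 0] the elimination only sets [x_j] to zero. *)
  by rewrite mul_elim_mx mxE !eqxx scale1r subrr sub0r scaler0 oppr0.
have /in_span_ideal_coker/eqP := in_span_ideal_mderiv Pyvar fP.
rewrite mderiv_fn_on // rmorphM /= !subst_mxX !rowE mulf_eq0.
have /andP[p1S p2S] := pS.
have ncoker j : ~~ inside (S :\ j) p -> j \in S ->
    lin (unit_row k (X j) *m cokermx P) != 0.
  move=> pj jS; have := Pxvar j pj jS; rewrite submxE; apply: contraNneq => e0.
  by apply/eqP/lin_inj; rewrite e0 linear0.
by rewrite !(negPf (ncoker _ _ _)) // /inside !inE eqxx ?andbF.
Qed.

End LowerBound.

(** * Slice rank and spaces of linear forms *)

Section SliceRankBounds.
Variables (k : fieldType) (N : nat).
Local Notation linform := (dhomog N.+1 k 1).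
Implicit Types (f : dhomog N.+1 k 3) (P : {vspace linform}).

(** A basis of [P] generates the same ideal as [P]. *)
Lemma slice_rank_le f P :
  in_ideal (fun g : {mpoly k[N.+1]} => exists2 l : linform, l \in P & g = val l)
    (val f) ->
  (slice_rank f <= \dim P)%N.
Proof.
move=> fP; rewrite /slice_rank; case: ex_minnP => r _; apply; apply/asboolP.
exists (vbasis P); case: fP => m [c [g [gP ->]]].
have /fin_all_exists2 [l lP gE] := gP.
exists (\dim P), (fun j => \sum_i coord (vbasis P) j (l i) *: c i).
exists (fun j => val (tnth (vbasis P) j)); split=> [j|]; first by exists j.
under [RHS]eq_bigr do rewrite mulr_suml.
rewrite exchange_big; apply: eq_bigr => i _ /=.
rewrite gE {1}(coord_vbasis (lP i)) raddf_sum mulr_sumr.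
apply: eq_bigr => j _ /=.
by rewrite -scalerAr -scalerAl (tnth_nth 0).
Qed.

(** The rows are the coefficients of a minimal family of generators. *)
Lemma slice_rank_matrix f :
  exists P : 'M[k]_(slice_rank f, N.+1), in_span_ideal P (val f).
Proof.
rewrite /slice_rank; case: ex_minnP => r /asboolP[l [m [c [g [gl fE]]]]] _.
exists (\matrix_(i < r) \row_j (val (tnth l i))@_U_(j)), m, c, g; split=> // i.
have [j ->] := gl i; eexists; last exact/linP/dhomog_is_dhomog.
by apply: eq_row_sub (rowK _ j).
Qed.

Definition Xform i : linform := indhomog 1 'X_i.

Lemma val_Xform i : val (Xform i) = 'X_i.
Proof. by rewrite insubdK // dhomogX /= mdeg1. Qed.

Lemma Xform_span (L : {vspace linform}) : (forall i, Xform i \in L) -> L = fullv.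
Proof.
move=> XL; apply/eqP; rewrite eqEsubv subvf /=; apply/subvP => l _.
have -> : l = \sum_i (val l)@_U_(i) *: Xform i.
  apply: val_inj; rewrite [LHS]linP ?dhomog_is_dhomog // raddf_sum.
  by apply: eq_bigr => i _ /=; rewrite val_Xform mxE.
by apply: memv_suml => i _; apply: memvZ.
Qed.

Lemma dim_linform : \dim {:linform} = N.+1.
Proof. by rewrite dimvf /dim /= bin1. Qed.

End SliceRankBounds.

Lemma memv_family_sum (K : fieldType) (V : vectType K) (F : {vspace V} -> Prop)
    U v :
  F U -> v \in U -> v \in family_sum F.
Proof.
move=> FU vU; rewrite /family_sum; case: cid => L /= Lsum; apply/Lsum.
exists [:: U]; rewrite big_seq1; split=> // W.
by rewrite inE => /eqP->.
Qed.

Lemma card_pairs n : #|pairs n| = 'C(n, 2).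
Proof.
rewrite card_sig -sum1_card -bin2_sum big_mkord.
rewrite (eq_bigl (fun p : 'I_n * 'I_n => xpredT p.1 && (p.1 < p.2)%N)) //.
rewrite -(pair_big_dep xpredT (fun i j : 'I_n => (i < j)%N) (fun _ _ => 1%N)) /=.
rewrite (exchange_big_dep xpredT) //=; apply: eq_bigr => j _.
by rewrite (big_ord_narrow (ltnW (ltn_ord j))) sum1_card card_ord.
Qed.

(** * The spaces of the minimal families of variables *)

Section Fn.
Variables (k : fieldType) (n : nat).
Hypothesis n_ge2 : (2 <= n)%N.

Let n_gt0 : (0 < n)%N := ltnW n_ge2.

Lemma slice_rank_fn_ge : (n - 1 <= slice_rank (fn k n))%N.
Proof.
have [P fP] := slice_rank_matrix (fn k n).
rewrite leq_subLR add1n; apply: (@leq_trans (\rank P).+1); last first.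
  by rewrite ltnS rank_leq_row.
rewrite -[leqLHS]card_ord -cardsT; apply: (fn_on_ideal_rank n_gt0).
by rewrite fn_on_setT.
Qed.

Definition meets_terms (s : seq (fvar n)) := forall p : pairs n,
  [|| inl (val p).1 \in s, inl (val p).2 \in s | inr p \in s].

Definition span_vars (s : seq (fvar n)) : {vspace dhomog (nv n).+1 k 1} :=
  <<[seq Xform k (fvar_index z) | z <- s]>>%VS.

Lemma in_ideal_span_vars s : meets_terms s ->
  in_ideal (fun g : {mpoly k[(nv n).+1]} =>
    exists2 l : dhomog (nv n).+1 k 1, l \in span_vars s & g = val l)
    (val (fn k n)).
Proof.
move=> sP; apply: in_ideal_sum => p.
have sX z : z \in s -> exists2 l : dhomog (nv n).+1 k 1,
    l \in span_vars s & 'X_(fvar_index z) = val l.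
  move=> zs; exists (Xform k (fvar_index z)); last by rewrite val_Xform.
  exact/memv_span/map_f.
have /or3P[/sX|/sX|/sX] := sP p => gP; do 2 eexists; split; try exact: gP.
- by rewrite -mulrA mulrC.
- by rewrite mulrAC.
- by [].
Qed.

Lemma slice_rank_fn_le s : meets_terms s -> (slice_rank (fn k n) <= size s)%N.
Proof.
move=> sP; apply: leq_trans (slice_rank_le (in_ideal_span_vars sP)) _.
by apply: leq_trans (dim_span _) _; rewrite size_map.
Qed.

(** The dimension is at most [size s] and, since [f_n] lies in the ideal, at
least the slice rank; the lower bound makes these numbers equal. *)
Lemma min_space_span_vars s : meets_terms s -> (size s <= n - 1)%N ->
  min_space (fn k n) (span_vars s).
Proof.
move=> sP sn; split; last exact: in_ideal_span_vars.
apply/eqP; rewrite eqn_leq slice_rank_le ?andbT; last exact: in_ideal_span_vars.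
apply: leq_trans (dim_span _) _; rewrite size_map.
exact: leq_trans sn slice_rank_fn_ge.
Qed.

Lemma meets_terms_x (i : 'I_n) : meets_terms [seq inl j | j <- enum (predC1 i)].
Proof.
move=> p; have := valP p; rewrite !(mem_map (@inl_inj _ _)) !mem_enum !inE.
by have [->|//] := eqVneq (val p).1 i;
  have [->|//] := eqVneq (val p).2 i; rewrite ltnn.
Qed.

(** A pair other than [p] has an entry outside [p]. *)
Lemma meets_terms_y (p : pairs n) :
  meets_terms
    (inr p :: [seq inl j | j <- enum (predC (pred2 (val p).1 (val p).2))]).
Proof.
move=> q; rewrite !inE !(mem_map (@inl_inj _ _)) !mem_enum !inE.
rewrite [inr q == inr p](inj_eq (@inr_inj _ _)) -(inj_eq val_inj q p).
have := valP p; have := valP q; case: (val p) (val q) => [a b] [c d] /= cd ab.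
rewrite xpair_eqE; move: cd; have [->|ca] := eqVneq c a => cd /=.
  by rewrite -[d == a]val_eqE (gtn_eqF cd) /=; case: eqVneq; rewrite ?orbT.
move: cd; have [->|//] := eqVneq c b => cd.
rewrite -[d == a]val_eqE (gtn_eqF (ltn_trans ab cd)).
by rewrite -[d == b]val_eqE (gtn_eqF cd).
Qed.

Lemma ex_cover (z : fvar n) :
  exists s, [/\ meets_terms s, (size s <= n - 1)%N & z \in s].
Proof.
case: z => [j|p].
  have [i ij] : exists i : 'I_n, i != j.
    have /card_gt1P[a [b [_ _ ab]]] : (1 < #|'I_n|)%N by rewrite card_ord.
    have [aj|] := eqVneq a j; last by exists a.
    by exists b; rewrite -aj eq_sym.
  exists [seq inl j | j <- enum (predC1 i)]; split; first exact: meets_terms_x.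
    by rewrite size_map -cardE cardC1 card_ord subn1.
  by rewrite mem_map ?mem_enum ?inE 1?eq_sym //; exact: inl_inj.
exists (inr p :: [seq inl j | j <- enum (predC (pred2 (val p).1 (val p).2))]).
split; [exact: meets_terms_y| |exact: mem_head].
rewrite /= size_map -cardE.
have := cardC (pred2 (val p).1 (val p).2); rewrite card2 card_ord.
rewrite neq_ltn (valP p) /= add2n => nE.
by rewrite ltn_subRL nE.
Qed.

Lemma L_space_fn : L_space (fn k n) = fullv.
Proof.
apply: Xform_span => i.
have [z ->] : exists z : fvar n, i = fvar_index z.
  by have [h _ hK] := fvar_index_bij n_gt0; exists (h i); rewrite hK.
have [s [sP sn zs]] := ex_cover z.
apply: (memv_family_sum (min_space_span_vars sP sn)).
exact/memv_span/map_f.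
Qed.

End Fn.

Theorem proposition3p3 (k : fieldType) (n : nat) (hn : (2 <= n)%N) :
  slice_rank (fn k n) = (n - 1)%N /\
  \dim (L_space (fn k n)) = (n + 'C(n, 2))%N.
Proof.
have n_gt0 : (0 < n)%N := ltnW hn.
split.
  apply/eqP; rewrite eqn_leq slice_rank_fn_ge // andbT.
  have [s [sP sn _]] := ex_cover hn (inl (Ordinal n_gt0)).
  exact: leq_trans (slice_rank_fn_le k sP) sn.
rewrite (L_space_fn k hn) dim_linform.
have := bij_eq_card (fvar_index_bij n_gt0).
by rewrite card_sum !card_ord card_pairs => <-.
Qed.
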